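(* Let $c$ be a complex number and let $(a_n)_{n\ge0},(b_n)_{n\ge0},(d_n)_{n\ge0},(f_n)_{n\ge0}$ be sequences of complex numbers with $a_n\neq 0$ for all $n$. Set $c_n=c$ and $e_n=-1$ for all $n\ge 0$, and suppose that for all $n\ge 0$: $$a_{n+1}=-\frac{a_n^3e_n+a_n^2d_n-a_nc_nb_n+b_n^2}{a_n^2},$$ $$b_{n+1}=-\frac{a_n^4f_n+c_na_n^3d_n-c_n^2a_n^2b_n+2c_na_nb_n^2-b_na_n^2d_n-b_n^3}{a_n^3},$$ $$d_{n+1}=-\frac{-2a_nc_nb_n+2b_n^2+a_n^2d_n}{a_n^2},\qquad f_{n+1}=-\frac{b_n}{a_n}.$$ Then for all $n\ge 0$, $$a_{n+2}a_{n+1}+a_{n+1}a_n=2a_0a_1+a_0(f_0+f_1+c)(2f_1+c)-\frac{\big(a_0(f_0+f_1+c)\big)^2}{a_{n+1}}.$$ *)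

(* Defs.v *)
From mathcomp Require Export all_boot all_order all_algebra.
From mathcomp Require Export reals complex.

Set Implicit Arguments.
Unset Strict Implicit.
Unset Printing Implicit Defensive.

(* With R : realType (the real numbers), R[i] is the field of complex numbers. *)

(* Main.v *)
(**
  With [f_{n+1} = - b_n / a_n] the recurrences for [a], [b], [d] become
  polynomial.  Two quantities are then conserved:
    [M = a_n (f_n + f_{n+1} + c)]  and  [J = a_{n+1} a_n + M f_{n+1}].
  The second follows from the first because
    [a_{n+2} - a_n = - (f_{n+2} - f_{n+1}) (f_{n+2} + f_{n+1} + c)].
  Adding the expressions of [J] at [n] and [n + 1] and eliminating
  [f_{n+1} + f_{n+2} = M / a_{n+1} - c] gives the claim.
*)
Require Import Defs.
From mathcomp Require Import ring.
Import GRing.Theory.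
Local Open Scope ring_scope.
Local Open Scope complex_scope.

(** With denominators cleared, both inductions reduce to polynomial identities. *)
Lemma conserved_quantities (A : comNzRingType) (c : A) (a b d f : nat -> A)
  (bE : forall n, b n = - (f n.+1 * a n))
  (aS : forall n, a n.+1 = a n - d n - c * f n.+1 - f n.+1 ^+ 2)
  (bS : forall n, b n.+1 = - (a n * f n + (c + f n.+1) * (a n - a n.+1)))
  (dS : forall n, d n.+1 = - (2 * c * f n.+1) - 2 * f n.+1 ^+ 2 - d n) (n : nat) :
  let M := a 0%N * (f 0%N + f 1%N + c) in
  a n * (f n + f n.+1 + c) = M /\
  a n.+1 * a n + M * f n.+1 = a 1%N * a 0%N + M * f 1%N.
Proof.
move=> M.
have ME m : a m * (f m + f m.+1 + c) = M.
  elim: m => // m <-.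
  (* Isolates [f m.+2 * a m.+1], which is [- b m.+1], so that [bS] brings back [f m]. *)
  have -> : a m.+1 * (f m.+1 + f m.+2 + c)
    = a m.+1 * (f m.+1 + c) - - (f m.+2 * a m.+1) by ring.
  by rewrite -bE bS; ring.
split=> //; elim: n => // n <-.
have a2S : a n.+2 - a n = - ((f n.+2 - f n.+1) * (f n.+1 + f n.+2 + c)).
  by rewrite (aS n.+1) dS (aS n); ring.
apply/eqP; rewrite -subr_eq0; apply/eqP.
(* At index [n.+1], [M] supplies the factor [a n.+1] that cancels against [a2S]. *)
rewrite -(ME n.+1).
have -> : a n.+2 = (a n.+2 - a n) + a n by ring.
by rewrite a2S; ring.
Qed.

Theorem theorem2p2 (R : realType) (c : R[i]) (a b cc d e f : nat -> R[i])
  (a_neq0 : forall n : nat, a n != 0)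
  (ccE : forall n : nat, cc n = c)
  (eE : forall n : nat, e n = - 1)
  (aS : forall n : nat, a n.+1 =
    - ((a n ^+ 3 * e n + a n ^+ 2 * d n - a n * cc n * b n + b n ^+ 2)
       / a n ^+ 2))
  (bS : forall n : nat, b n.+1 =
    - ((a n ^+ 4 * f n + cc n * a n ^+ 3 * d n - cc n ^+ 2 * a n ^+ 2 * b n
        + 2 * cc n * a n * b n ^+ 2 - b n * a n ^+ 2 * d n - b n ^+ 3)
       / a n ^+ 3))
  (dS : forall n : nat, d n.+1 =
    - ((- 2 * a n * cc n * b n + 2 * b n ^+ 2 + a n ^+ 2 * d n) / a n ^+ 2))
  (fS : forall n : nat, f n.+1 = - (b n / a n)) :
  forall n : nat,
    a n.+2 * a n.+1 + a n.+1 * a n =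
      2 * a 0%N * a 1%N + a 0%N * (f 0%N + f 1%N + c) * (2 * f 1%N + c)
      - (a 0%N * (f 0%N + f 1%N + c)) ^+ 2 / a n.+1.
Proof.
move=> n.
have bE m : b m = - (f m.+1 * a m) by rewrite fS mulNr opprK divfK.
have aS' m : a m.+1 = a m - d m - c * f m.+1 - f m.+1 ^+ 2.
  by rewrite aS ccE eE bE; field.
have dS' m : d m.+1 = - (2 * c * f m.+1) - 2 * f m.+1 ^+ 2 - d m.
  by rewrite dS ccE bE; field.
have bS' m : b m.+1 = - (a m * f m + (c + f m.+1) * (a m - a m.+1)).
  by rewrite bS aS' ccE bE; field.
have CQ := conserved_quantities _ _ _ _ _ _ bE aS' bS' dS'.
have [_ J0] := CQ n; have [M1 J1] := CQ n.+1.
move: (a 0%N * _) M1 J0 J1 => M M1 J0 J1.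
have sumJ : a n.+2 * a n.+1 + a n.+1 * a n
  = 2 * (a 1%N * a 0%N + M * f 1%N) - M * (f n.+1 + f n.+2).
  (* The doubled constant is split, one copy read at [n], the other at [n.+1]. *)
  by rewrite mulr_natl mulr2n -{1}J0 -J1; ring.
rewrite sumJ.
have -> : f n.+1 + f n.+2 = M / a n.+1 - c by rewrite -M1; field.
by field.
Qed.
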